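(* Let $G$ be a finite simple graph such that $L(G)^2$ is perfect. Then $G$ does not contain, as an induced subgraph, a cycle $C_n$ with $n\ge 7$, a fertile sunflower sprout of size $5$, or a fertile sprout of type $A$.
   Context: All graphs are finite and simple. $L(G)$ is the line graph of $G$; $H^2$ is the square of $H$ (same vertices, distinct vertices adjacent iff at distance at most $2$ in $H$). A graph is perfect if every induced subgraph has chromatic number equal to its clique number. Sunflower sprout of size $n$: a graph $S=(U\cup V,E)$ with $V\cap U=\emptyset$, where $V=\{v_1,\dots,v_n\}$ induces a (chordless) cycle $v_1v_2\cdots v_n$ of length $n$ and $U=\{u_1,\dots,u_n\}$ is a set of not necessarily distinct vertices, such that $u_i\ne u_j$ whenever $j\notin\{i-1,i,i+1\}$ modulo $n$, and $v_iu_i\in E$ for all $i$. It is infertile if there is an edge $u_iu_j$ or $u_iv_j$ for some $i$ and some $j\notin\{i-1,i,i+1\}$ modulo $n$, and fertile otherwise. Fertile sprout of type $A$: any graph on nine vertices $x_1,\dots,x_6,y_6,y_1,y_2$ in which $x_1x_2x_3x_4x_5x_6$ is an induced $6$-cycle, $y_6x_6,\ y_1x_1,\ y_2x_2$ are edges, an arbitrary subset of the edges $y_1y_2,\ y_1x_2,\ y_1x_6,\ y_2x_1,\ y_2x_3,\ y_6y_1,\ y_6x_1,\ y_6x_5$ is present, and there are no other edges. *)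

(* Defs.v *)
From mathcomp Require Import all_boot.

Set Implicit Arguments.
Unset Strict Implicit.
Unset Printing Implicit Defensive.

Record sgraph := SGraph {
  svertex :> finType;
  adj : rel svertex;
  adj_sym : symmetric adj;
  adj_irr : irreflexive adj }.

Section Induced.
Variables (G : sgraph) (S : {set G}).

Definition induced_adj : rel {x : G | x \in S} :=
  fun x y => adj (val x) (val y).

Lemma induced_sym : symmetric induced_adj.
Proof. by move=> x y; apply: adj_sym. Qed.

Lemma induced_irr : irreflexive induced_adj.
Proof. by move=> x; apply: adj_irr. Qed.

Definition induced : sgraph := SGraph induced_sym induced_irr.
End Induced.

(** [F] is isomorphic to an induced subgraph of [G]. *)
Definition contains_induced (G F : sgraph) : Prop :=
  exists2 f : F -> G, injective f & forall x y, adj (f x) (f y) = adj x y.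

Definition clique (G : sgraph) (K : {set G}) : bool :=
  [forall x in K, forall y in K, (x != y) ==> adj x y].

Definition clique_number (G : sgraph) : nat :=
  \max_(K : {set G} | clique K) #|K|.

Definition colorable (G : sgraph) (k : nat) : bool :=
  [exists c : {ffun G -> 'I_k},
    [forall x, forall y, adj x y ==> (c x != c y)]].

Lemma colorable_ex (G : sgraph) : exists k, colorable G k.
Proof.
exists #|G|; apply/existsP; exists [ffun x => enum_rank x].
apply/forallP => x; apply/forallP => y; apply/implyP => xy.
rewrite !ffunE (inj_eq enum_rank_inj).
by apply: contraTneq xy => ->; rewrite adj_irr.
Qed.

Definition chromatic_number (G : sgraph) : nat := ex_minn (colorable_ex G).

Definition perfect (G : sgraph) : Prop :=
  forall S : {set G},
    chromatic_number (induced S) = clique_number (induced S).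

(** An edge is represented by the set of its two ends. *)

Section LineGraph.
Variable G : sgraph.

Definition edges : {set {set G}} :=
  [set e : {set G} | [exists x, exists y, adj x y && (e == [set x; y])]].

Definition line_adj : rel {e : {set G} | e \in edges} :=
  fun e f => (e != f) && (val e :&: val f != set0).

Lemma line_sym : symmetric line_adj.
Proof. by move=> e f; rewrite /line_adj eq_sym setIC. Qed.

Lemma line_irr : irreflexive line_adj.
Proof. by move=> e; rewrite /line_adj eqxx. Qed.

Definition line_graph : sgraph := SGraph line_sym line_irr.
End LineGraph.

Definition walk_of_length (G : sgraph) (k : nat) (x y : G) : bool :=
  [exists p : k.-tuple G, path (@adj G) x p && (last x p == y)].

Definition dist_le (G : sgraph) (d : nat) (x y : G) : bool :=
  [exists k : 'I_d.+1, walk_of_length k x y].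

Section Square.
Variable G : sgraph.

Definition square_adj : rel G := fun x y => (x != y) && dist_le 2 x y.

Lemma walk_rev k (x y : G) : walk_of_length k x y -> walk_of_length k y x.
Proof.
case/existsP => p /andP[px /eqP <-].
have sz : size (rev (belast x p)) == k by rewrite size_rev size_belast size_tuple.
apply/existsP; exists (Tuple sz); apply/andP; split; rewrite /=.
  by rewrite rev_path (eq_path (e' := @adj G)) // => a b; apply: adj_sym.
by case: (tval p) => //= a s; rewrite rev_cons last_rcons.
Qed.

Lemma square_sym : symmetric square_adj.
Proof.
move=> x y; rewrite /square_adj eq_sym; congr (_ && _).
by apply/existsP/existsP => -[k] /walk_rev w; exists k.
Qed.

Lemma square_irr : irreflexive square_adj.
Proof. by move=> x; rewrite /square_adj eqxx. Qed.

Definition square : sgraph := SGraph square_sym square_irr.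
End Square.

(** [ordS] and [ord_pred] are successor and predecessor modulo [n];
    [cycle_graph n] is the cycle [C_n] only for [n >= 3]. *)

Section Cycle.
Variable n : nat.

Definition cycle_adj : rel 'I_n :=
  fun i j => (i != j) && ((j == ordS i) || (i == ordS j)).

Lemma cycle_sym : symmetric cycle_adj.
Proof. by move=> i j; rewrite /cycle_adj eq_sym orbC. Qed.

Lemma cycle_irr : irreflexive cycle_adj.
Proof. by move=> i; rewrite /cycle_adj eqxx. Qed.

Definition cycle_graph : sgraph := SGraph cycle_sym cycle_irr.

Definition cyc_near (i j : 'I_n) : bool := j \in [:: ord_pred i; i; ordS i].
End Cycle.

(** The labelling [v, u] is part of the data, as fertility refers to it; [u]
    need not be injective. *)

Record sunflower_sprout (n : nat) (S : sgraph) (v u : 'I_n -> S) : Prop :=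
  SunflowerSprout {
    sprout_size : 3 <= n;
    sprout_v_inj : injective v;
    sprout_cycle : forall i j, adj (v i) (v j) = cycle_adj i j;
    sprout_disjoint : forall i j, v i != u j;
    sprout_cover : forall z : S, (exists i, z = v i) \/ (exists i, z = u i);
    sprout_u_neq : forall i j, ~~ cyc_near i j -> u i != u j;
    sprout_edge : forall i, adj (v i) (u i) }.

Definition infertile (n : nat) (S : sgraph) (v u : 'I_n -> S) : Prop :=
  exists i j, ~~ cyc_near i j /\ (adj (u i) (u j) \/ adj (u i) (v j)).

Definition fertile_sunflower_sprout (n : nat) (S : sgraph) : Prop :=
  exists v u : 'I_n -> S, sunflower_sprout v u /\ ~ infertile v u.

(** Up to orientation, the edges are the required pairs and an arbitrary subset
    of the optional ones; so [x1 ... x6] is an induced cycle. *)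
Definition fertile_sprout_type_A (S : sgraph) : Prop :=
  exists x1 x2 x3 x4 x5 x6 y6 y1 y2 : S,
    let vertices := [:: x1; x2; x3; x4; x5; x6; y6; y1; y2] in
    let required :=
      [:: (x1, x2); (x2, x3); (x3, x4); (x4, x5); (x5, x6); (x6, x1);
          (y6, x6); (y1, x1); (y2, x2)] in
    let optional :=
      [:: (y1, y2); (y1, x2); (y1, x6); (y2, x1); (y2, x3);
          (y6, y1); (y6, x1); (y6, x5)] in
    [/\ uniq vertices,
        forall z : S, z \in vertices,
        forall a b, (a, b) \in required -> adj a b
      & forall a b, adj a b ->
          ((a, b) \in required ++ optional) ||
          ((b, a) \in required ++ optional)].

(* Main.v *)
Require Import Defs.
From mathcomp Require Import all_boot.
From mathcomp Require Import zify.

Set Implicit Arguments.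
Unset Strict Implicit.
Unset Printing Implicit Defensive.

(** Two edges of [G] are adjacent in the square of [L(G)] exactly when some end
    of one equals or is adjacent to some end of the other. A forbidden graph is
    therefore excluded by exhibiting finitely many of its edges on which this
    relation has no clique of size [k + 1] but also no proper colouring with
    [k] colours: in a perfect graph every family of vertices without a clique
    of size [k + 1] has such a colouring ([line_square_coloring]). Since the
    relation only looks at adjacencies between ends of the chosen edges, it can
    be computed inside the forbidden induced subgraph.

    For both kinds of sprouts the chosen edges form a pentagon in the square of
    the line graph ([no_sprout_pentagon]). In a fertile sunflower sprout of
    size 5 they are the edges [v_i u_i]: consecutive ones are joined by
    [v_i v_(i+1)], and fertility says that the others are far apart. In a
    fertile sprout of type A they are, in cyclic order, [x1 y1], [x2 y2],
    [x3 x4], [x4 x5], [x6 y6], whichever optional edges are present.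

    For the cycle [C_n] with [n >= 7], the edges are numbered cyclically and
    are adjacent in the square when their indices differ cyclically by at most
    2 ([long_cycle_coloring]). All the edges together have no clique of size 4,
    and in a proper 3-colouring any three consecutive edges use all three
    colours, so the colouring has period 3 and 3 divides [n]
    ([long_cycle_dvd3]). If 3 does divide [n], then [n >= 9] and only the edges
    1, 3, 5, 7, 8, 10, 11, ..., [n-2], [n-1] are kept. No three cyclically
    consecutive indices remain, so there is no triangle; but consecutive
    members are still adjacent, and they form a closed walk of odd length, so
    two colours do not suffice. *)

(** * Colourings of perfect graphs *)

Lemma colorableP (H : sgraph) (k : nat) :
  reflect (exists c : H -> 'I_k, forall x y, adj x y -> c x != c y)
          (colorable H k).
Proof.
apply: (iffP existsP) => -[c cP].
  by exists c => x y; have /forallP/(_ y)/implyP := forallP cP x.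
exists [ffun x => c x]; apply/'forall_forallP => x y.
by apply/implyP; rewrite !ffunE; apply: cP.
Qed.

Lemma colorable_chromatic (H : sgraph) : colorable H (chromatic_number H).
Proof. by rewrite /chromatic_number; case: ex_minnP. Qed.

(** Perfection only speaks of induced subgraphs on sets of vertices. Naming the
    vertices by an arbitrary finite type lets the applications work with
    explicit indices, and colours in [nat] leave the arithmetic about them to
    [lia]. *)
Lemma perfect_coloring (H : sgraph) (T : finType) (h : T -> H) (S : {set T})
    (k : nat) :
  perfect H -> injective h ->
  (forall A : {set T}, A \subset S ->
     {in A &, forall i j, i != j -> adj (h i) (h j)} -> #|A| <= k) ->
  exists c : T -> nat, (forall i, i \in S -> c i < k) /\
    {in S &, forall i j, adj (h i) (h j) -> c i != c j}.
Proof.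
move=> perfH h_inj small.
pose I := induced (h @: S).
have omega_le : clique_number I <= k.
  apply/bigmax_leqP => K K_clique.
  pose A := [set i in S | h i \in val @: K].
  have KA : val @: K = h @: A.
    apply/setP => x; apply/idP/imsetP => [xK | [i]].
      case/imsetP: (xK) => y yK xE; have /imsetP[i iS yE] := valP y.
      by exists i; rewrite ?inE ?iS -?yE -?xE.
    by rewrite inE => /andP[_ ?] ->.
  rewrite -(card_imset _ val_inj) KA card_imset //; apply: small => [|i j].
    by apply/subsetP => i; rewrite inE => /andP[].
  rewrite !inE => /andP[_ /imsetP[x xK hi]] /andP[_ /imsetP[y yK hj]] ij.
  rewrite hi hj; have /forall_inP/(_ x xK)/forall_inP/(_ y yK)/implyP := K_clique.
  by apply; apply: contra_neq ij => xy; apply: h_inj; rewrite hi hj xy.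
have /colorableP[c cP] := colorable_chromatic I.
have chi_le : chromatic_number I <= k by rewrite perfH.
have hS i : i \in S -> h i \in h @: S by apply: imset_f.
exists (fun i => if insub (h i) is Some x then val (c x) else 0); split.
  by move=> i /hS hi; rewrite insubT /= (leq_trans (ltn_ord _)).
move=> i j /hS hi /hS hj ij; rewrite !insubT /=.
by rewrite (inj_eq val_inj); apply: cP.
Qed.

Definition close (G : sgraph) (x y : G) : bool := (x == y) || adj x y.

Lemma dist_le2P (H : sgraph) (x y : H) :
  dist_le 2 x y = [|| x == y, adj x y | [exists z, adj x z && adj z y]].
Proof.
apply/existsP/or3P => [[[[|[|[|k]]] //= lek] /existsP[p]]|].
- by rewrite tuple0 /= => xy; constructor 1.
- case/tupleP: p => a p; rewrite tuple0 /= andbT => /andP[xa /eqP <-].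
  by constructor 2.
- case/tupleP: p => a p; case/tupleP: p => b p.
  rewrite tuple0 /= andbT => /andP[ab /eqP <-].
  by constructor 3; apply/existsP; exists a.
case=> [/eqP <-|xy|/existsP[z /andP[xz zy]]].
- exists (inord 0); apply/existsP; rewrite inordK //.
  by exists [tuple]; rewrite /= eqxx.
- exists (inord 1); apply/existsP; rewrite inordK //.
  by exists [tuple y]; rewrite /= xy eqxx.
- exists (inord 2); apply/existsP; rewrite inordK //.
  by exists [tuple z; y]; rewrite /= xz zy eqxx.
Qed.

(** * The square of a line graph *)

Definition edges_close (G : sgraph) (x y z t : G) : bool :=
  [|| close x z, close x t, close y z | close y t].

Lemma pair_edge (G : sgraph) (x y : G) :
  adj x y -> [set x; y] \in edges G.
Proof.
by move=> xy; rewrite inE; apply/existsP; exists x; apply/existsP; exists y;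
  rewrite xy eqxx.
Qed.

Lemma edge_ends_close (G : sgraph) (e : {set G}) x y :
  e \in edges G -> x \in e -> y \in e -> close x y.
Proof.
rewrite inE => /existsP[a /existsP[b /andP[ab /eqP ->]]].
by rewrite /close !inE => /orP[]/eqP-> /orP[]/eqP->; 
  rewrite ?eqxx ?ab ?orbT // adj_sym ab orbT.
Qed.

(** A path of length 2 in the line graph passes through an edge [g] meeting both
    [e] and [f], and the two meeting points are ends of [g], hence close. Conversely,
    if [xy] is an edge from [e] to [f] then it is such a [g], unless it coincides
    with [e] or [f], in which case [e] and [f] already share an end. *)
Lemma square_line_adj (G : sgraph) (e f : line_graph G) :
  @adj (square (line_graph G)) e f =
  (e != f) && [exists x in val e, exists y in val f, close x y].
Proof.
rewrite /= /square_adj dist_le2P; case: eqVneq => //= ef.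
have meet (g h : line_graph G) :
    reflect (g != h /\ exists2 x, x \in val g & x \in val h) (adj g h).
  rewrite /= /line_adj; apply: (iffP andP) => -[-> gh]; split=> //.
    by case/set0Pn: gh => x; rewrite inE => /andP[? ?]; exists x.
  by case: gh => x xg xh; apply/set0Pn; exists x; rewrite inE xg.
apply/orP/exists_inP => [[/meet[_ [x xe xf]]|/existsP[g]]|[x xe]].
- by exists x => //; apply/exists_inP; exists x; rewrite /close ?eqxx.
- case/andP => /meet[_ [x xe xg]] /meet[_ [y yg yf]].
  exists x => //; apply/exists_inP; exists y => //.
  exact: edge_ends_close (valP g) xg yg.
case/exists_inP => y yf; rewrite /close; case: eqVneq => [xy _ | _ /= xy].
  by left; apply/meet; split=> //; exists x => //; rewrite xy.
pose g : line_graph G := Sub [set x; y] (pair_edge xy).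
have [xg yg] : x \in val g /\ y \in val g by rewrite !inE !eqxx orbT.
have [ge | ge] := eqVneq e g.
  by left; apply/meet; split=> //; exists y; rewrite // ge.
have [gf | gf] := eqVneq g f.
  by left; apply/meet; split=> //; exists x; rewrite // -gf.
right; apply/existsP; exists g; apply/andP; split; apply/meet; split=> //.
  by exists x.
by exists y.
Qed.

(** The only way in which perfection of the square of the line graph is used:
    each forbidden subgraph supplies edges [a i, b i] that refute the
    conclusion. *)
Lemma line_square_coloring (G : sgraph) (T : finType) (a b : T -> G)
    (S : {set T}) (k : nat) :
  perfect (square (line_graph G)) ->
  (forall i, adj (a i) (b i)) -> injective (fun i => [set a i; b i]) ->
  (forall A : {set T}, A \subset S ->
     {in A &, forall i j, i != j -> edges_close (a i) (b i) (a j) (b j)} ->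
     #|A| <= k) ->
  exists c : T -> nat, (forall i, i \in S -> c i < k) /\
    {in S &, forall i j, i != j -> edges_close (a i) (b i) (a j) (b j) ->
                         c i != c j}.
Proof.
move=> perfG ab ab_inj small.
pose h i : square (line_graph G) := Sub [set a i; b i] (pair_edge (ab i)).
have h_inj : injective h by move=> i j /(congr1 val) /ab_inj.
have h_adj i j : adj (h i) (h j) =
    (i != j) && edges_close (a i) (b i) (a j) (b j).
  rewrite square_line_adj (inj_eq h_inj); congr (_ && _).
  apply/exists_inP/or4P => [[x]|].
    rewrite !inE => /orP[]/eqP-> /exists_inP[y];
      rewrite !inE => /orP[]/eqP-> ?;
      by [constructor 1|constructor 2|constructor 3|constructor 4].
  have get x y : x \in val (h i) -> y \in val (h j) -> close x y ->
      exists2 x, x \in val (h i) & [exists y in val (h j), close x y].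
    by move=> xi yj xy; exists x => //; apply/exists_inP; exists y.
  by case; apply: get; rewrite !inE eqxx ?orbT.
have [|c [c_lt cP]] := @perfect_coloring _ T h S k perfG h_inj.
  move=> A AS A_clique; apply: small => // i j iA jA ij.
  by have := A_clique i j iA jA ij; rewrite h_adj ij.
exists c; split=> // i j iS jS ij cl; apply: cP => //.
by rewrite h_adj ij.
Qed.

(** * Pentagons in the square of the line graph *)

Lemma enum_ord_sorted (n : nat) (A : {set 'I_n}) :
  sorted ltn [seq val i | i <- enum A].
Proof.
rewrite sorted_map /enum_mem; apply: sorted_filter.
  by move=> x y z; apply: ltn_trans.
by have := iota_ltn_sorted 0 n; rewrite -val_enum_ord sorted_map enumT.
Qed.

(** Listing the elements of a large set of indices in increasing order turns the
    absence of cliques into linear arithmetic without any symmetric cases. *)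
Lemma ord_card_ge3 (n : nat) (A : {set 'I_n}) : 2 < #|A| ->
  exists i j k : 'I_n, [/\ i \in A, j \in A, k \in A & i < j < k].
Proof.
have := enum_ord_sorted A; rewrite cardE.
have: {subset enum A <= A} by move=> i; rewrite mem_enum.
case: (enum A) => [|i [|j [|k s]]] //= sub /and3P[ij jk _] _.
by exists i, j, k; rewrite ij jk; split=> //; apply: sub; rewrite !inE eqxx ?orbT.
Qed.

Lemma ord_card_ge4 (n : nat) (A : {set 'I_n}) : 3 < #|A| ->
  exists i j k l : 'I_n,
    [/\ i \in A, j \in A, k \in A, l \in A & [&& i < j, j < k & k < l]].
Proof.
have := enum_ord_sorted A; rewrite cardE.
have: {subset enum A <= A} by move=> i; rewrite mem_enum.
case: (enum A) => [|i [|j [|k [|l s]]]] //= sub /and4P[ij jk kl _] _.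
by exists i, j, k, l; rewrite ij jk kl; split=> //; apply: sub;
  rewrite !inE eqxx ?orbT.
Qed.

(** Replaces the remainder in the definition of [ordS] by linear arithmetic. *)
Lemma eq_ordS (n : nat) (i j : 'I_n) :
  (j == ordS i) =
  ((j == i.+1 :> nat) || (j == 0 :> nat) && (i.+1 == n)).
Proof.
rewrite -val_eqE /=; have := ltn_ord i; have := ltn_ord j.
rewrite leq_eqVlt => jn; rewrite leq_eqVlt => /orP[/eqP iE | lt_in].
  by rewrite iE modnn eqxx andbT; lia.
by rewrite modn_small //; lia.
Qed.

(** A pentagon has no triangle, and it is not bipartite. *)
Lemma no_pentagon (G : sgraph) (a b : 'I_5 -> G) :
  perfect (square (line_graph G)) ->
  (forall i, adj (a i) (b i)) -> injective (fun i => [set a i; b i]) ->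
  ~ (forall i j, i != j ->
       edges_close (a i) (b i) (a j) (b j) = cycle_adj i j).
Proof.
move=> perfG ab ab_inj close_cycle.
have nat_cycle (i j : 'I_5) : i < j ->
    cycle_adj i j = ((j == i.+1 :> nat) || (i == 0 :> nat) && (j == 4 :> nat)).
  by rewrite /cycle_adj !eq_ordS -val_eqE /=; have := ltn_ord j; lia.
have lt_neq (i j : 'I_5) : i < j -> i != j by rewrite -val_eqE /=; lia.
have [|c [c_lt cP]] := @line_square_coloring G _ a b setT 2 perfG ab ab_inj.
  move=> A _ A_clique; rewrite leqNgt; apply/negP => /ord_card_ge3.
  case=> i [j [k [iA jA kA /andP[ij jk]]]]; have ik := ltn_trans ij jk.
  have := (A_clique i j iA jA (lt_neq _ _ ij), A_clique j k jA kA (lt_neq _ _ jk),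
    A_clique i k iA kA (lt_neq _ _ ik)).
  rewrite !close_cycle ?lt_neq // !nat_cycle //; have := ltn_ord k.
  by move=> ? [[]]; lia.
have col i j : i < j < 5 -> j = i.+1 \/ (i = 0 /\ j = 4) ->
    c (inord i) != c (inord j).
  case/andP => ij j5 near; have i5 := ltn_trans ij j5.
  have ltij : (inord i : 'I_5) < (inord j : 'I_5) by rewrite !inordK.
  apply: cP; rewrite ?inE ?lt_neq // close_cycle ?lt_neq // nat_cycle //.
  by rewrite !inordK //; lia.
have lt2 i : c (inord i) < 2 by apply: c_lt; rewrite inE.
have := (lt2 0, lt2 1, lt2 2, lt2 3, lt2 4).
have := (col 0 1 isT (or_introl erefl), col 1 2 isT (or_introl erefl),
  col 2 3 isT (or_introl erefl), col 3 4 isT (or_introl erefl),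
  col 0 4 isT (or_intror (conj erefl erefl))).
move=> [[[[]]]] ? ? ? ? ? [[[[]]]]; lia.
Qed.

(** * Long cycles *)

(** For [i < j < n] this is cyclic distance at most 2 modulo [n]. *)
Definition near2 (n i j : nat) : bool := (j - i <= 2) || (n - 2 <= j - i).

(** The edge number [i] of the cycle joins [f i] to [f (ordS i)], so edges at
    cyclic distance 2 are joined by the edge between them, and being induced
    keeps all more distant edges apart. *)
Lemma long_cycle_coloring (G : sgraph) (n : nat) (S : pred nat) (k : nat) :
  perfect (square (line_graph G)) -> 7 <= n ->
  contains_induced G (cycle_graph n) ->
  (forall A : {set 'I_n}, (forall i, i \in A -> S i) ->
     {in A &, forall i j : 'I_n, i < j -> near2 n i j} -> #|A| <= k) ->
  exists c : nat -> nat, (forall i, i < n -> S i -> c i < k) /\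
    forall i j, i < j -> j < n -> S i -> S j -> near2 n i j -> c i != c j.
Proof.
case: n => // m perfG n_ge [f f_inj f_adj] small.
set n := m.+1 in n_ge f f_inj f_adj small *.
have f_close (i j : 'I_n) :
    close (f i) (f j) = [|| i == j, j == ordS i | i == ordS j].
  by rewrite /close f_adj /= /cycle_adj (inj_eq f_inj); case: eqVneq.
have f_edge i : adj (f i) (f (ordS i)).
  by rewrite f_adj /= /cycle_adj eqxx andbT eq_ordS; lia.
have edge_inj : injective (fun i => [set f i; f (ordS i)]).
  move=> i j ij.
  have: f i \in [set f j; f (ordS j)] by rewrite -ij !inE eqxx.
  have: f j \in [set f i; f (ordS i)] by rewrite ij !inE eqxx.
  rewrite !inE !(inj_eq f_inj) !eq_ordS -!val_eqE /= => A B.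
  by apply/val_inj => /=; lia.
have edge_close (i j : 'I_n) : i < j ->
    edges_close (f i) (f (ordS i)) (f j) (f (ordS j)) =
    near2 n i j.
  rewrite /near2 => ij; have jn := ltn_ord j.
  rewrite /edges_close !f_close !eq_ordS -!val_eqE /=.
  rewrite (modn_small (m := i.+1)); last lia.
  have [jE | jE] := eqVneq j.+1 n.
    by rewrite jE modnn; apply/idP/idP; lia.
  by rewrite modn_small; [apply/idP/idP|]; lia.
have lt_neq (i j : 'I_n) : i < j -> i != j by rewrite -val_eqE /=; lia.
pose SI := [set i : 'I_n | S i].
have [|c [c_lt cP]] :=
    @line_square_coloring G _ f (fun i => f (ordS i)) SI k perfG f_edge edge_inj.
  move=> A /subsetP AS A_clique; apply: small => [i /AS|i j iA jA ij].
    by rewrite inE.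
  by rewrite -edge_close // A_clique ?lt_neq.
exists (fun i => c (inord i)); split=> [i i_lt Si|i j ij j_lt Si Sj near].
  by apply: c_lt; rewrite inE inordK.
have i_lt := ltn_trans ij j_lt.
have ij' : (inord i : 'I_n) < (inord j : 'I_n) by rewrite !inordK.
apply: cP; rewrite ?inE ?inordK ?lt_neq //.
by rewrite edge_close // !inordK.
Qed.

(** Three consecutive edges get three different colours out of three, so the
    colour of edge [i + 3] must be that of edge [i]. Going once around the cycle,
    a remainder 1 or 2 of [n] modulo 3 gives the last edge the colour of edge 0
    or 1, which is at cyclic distance 1 or 2 from it. *)
Lemma long_cycle_dvd3 (G : sgraph) (n : nat) :
  perfect (square (line_graph G)) -> 7 <= n ->
  contains_induced G (cycle_graph n) -> 3 %| n.
Proof.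
move=> perfG n_ge cycG.
have [|c [c_lt cP]] := @long_cycle_coloring G n predT 3 perfG n_ge cycG.
  move=> A _ A_near; rewrite leqNgt; apply/negP => /ord_card_ge4.
  case=> i [j [k [l [iA jA kA lA /and3P[ij jk kl]]]]].
  have ik := ltn_trans ij jk; have jl := ltn_trans jk kl.
  have il := ltn_trans ik kl.
  have := A_near i l iA lA il; have := A_near i k iA kA ik.
  have := A_near j l jA lA jl; have := A_near i j iA jA ij.
  have := A_near j k jA kA jk; have := A_near k l kA lA kl.
  by have := ltn_ord l; rewrite /near2; lia.
have shift i : i + 3 < n -> c (i + 3) = c i.
  move=> i_lt; have step p q : i <= p -> p < q -> q <= i + 3 -> q - p <= 2 ->
      c p != c q.
    by move=> *; apply: cP => //; rewrite /near2; lia.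
  have lt3 p : p <= i + 3 -> c p < 3 by move=> *; apply: c_lt => //; lia.
  have := step i (i + 1); have := step i (i + 2).
  have := step (i + 1) (i + 2); have := step (i + 1) (i + 3).
  have := step (i + 2) (i + 3).
  have := lt3 i; have := lt3 (i + 1); have := lt3 (i + 2); have := lt3 (i + 3).
  lia.
have period q r : 3 * q + r < n -> c (3 * q + r) = c r.
  elim: q => [|q IHq] lt_n; first by rewrite muln0.
  have -> : 3 * q.+1 + r = 3 * q + r + 3 by lia.
  by rewrite shift ?IHq //; lia.
have [q nE] : exists q, n = 3 * q + n %% 3.
  by exists (n %/ 3); rewrite {1}(divn_eq n 3) mulnC.
have := ltn_pmod n (isT : 0 < 3); rewrite /dvdn.
case: (n %% 3) nE => [|[|[|//]]] // nE _.
  have /eqP[] : c 0 != c (3 * q + 0) by apply: cP; rewrite /near2 //; lia.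
  by rewrite period //; lia.
have /eqP[] : c 1 != c (3 * q + 1) by apply: cP; rewrite /near2 //; lia.
by rewrite period //; lia.
Qed.

(** When 3 divides [n], multiples of 3 are deleted, which leaves no three
    consecutive edges; around 3 the pattern is shifted to keep 3 and delete 2
    and 4. The shift makes the number of remaining edges [2 * (n / 3) - 1] instead
    of [2 * (n / 3)], so that alternating colours along them cannot close up. *)
Lemma no_long_cycle (G : sgraph) (n : nat) :
  perfect (square (line_graph G)) -> 7 <= n ->
  ~ contains_induced G (cycle_graph n).
Proof.
move=> perfG n_ge cycG.
have /dvdnP[q nE] := long_cycle_dvd3 perfG n_ge cycG.
pose S i := (i %% 3 != 0) && (i \notin [:: 2; 4]) || (i == 3).
have [|c [c_lt cP]] := @long_cycle_coloring G n S 2 perfG n_ge cycG.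
  move=> A AS A_near; rewrite leqNgt; apply/negP => /ord_card_ge3.
  case=> i [j [k [iA jA kA /andP[ij jk]]]]; have ik := ltn_trans ij jk.
  have := A_near i j iA jA ij; have := A_near i k iA kA ik.
  have := A_near j k jA kA jk; have := AS i iA; have := AS j jA.
  have := AS k kA.
  by have := ltn_ord k; rewrite /near2 /S !inE; lia.
have step i j : i < j -> j < n -> S i -> S j -> near2 n i j -> c i + c j = 1.
  move=> ij j_lt Si Sj near; have := cP i j ij j_lt Si Sj near.
  by have := c_lt i (ltn_trans ij j_lt) Si; have := c_lt j j_lt Sj; lia.
have c8 : c 8 = c 1.
  have := step 1 3; have := step 3 5; have := step 5 7; have := step 7 8.
  by rewrite /S /near2 /= ; lia.
have period p : 3 * p + 8 < n -> c (3 * p + 8) = c 1.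
  elim: p => [|p IHp] lt_n; first by rewrite muln0 add0n.
  have := step (3 * p + 8) (3 * p + 10); have := step (3 * p + 10) (3 * p.+1 + 8).
  by rewrite IHp /S /near2 ?inE; lia.
(* The index [3 * (q - 3) + 8] is [n - 1], at cyclic distance 2 from 1. *)
have := step 1 (3 * (q - 3) + 8); rewrite period /S /near2 ?inE /=; lia.
Qed.

(** * Sprouts *)

(** Choosing the first ends [a i] distinct, and distinct from all second ends,
    makes the five edges distinct even when second ends coincide. *)
Lemma no_sprout_pentagon (G F : sgraph) (a b : 'I_5 -> F) :
  perfect (square (line_graph G)) -> contains_induced G F ->
  injective a -> (forall i j, a i != b j) -> (forall i, adj (a i) (b i)) ->
  ~ (forall i j, i != j ->
       edges_close (a i) (b i) (a j) (b j) = cycle_adj i j).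
Proof.
move=> perfG [f f_inj f_adj] a_inj ab_neq ab close_cycle.
apply: (@no_pentagon G (f \o a) (f \o b)) => // [i|i j|i j ij] /=.
- by rewrite f_adj.
- move/setP/(_ (f (a i))); rewrite !inE eqxx !(inj_eq f_inj) (negbTE (ab_neq i j)).
  by rewrite orbF => /esym /eqP /a_inj.
- by rewrite -close_cycle // /edges_close /close !(inj_eq f_inj) !f_adj.
Qed.

Lemma cyc_nearE (n : nat) (i j : 'I_n) : cyc_near i j = (i == j) || cycle_adj i j.
Proof.
rewrite /cyc_near !inE /cycle_adj [j == i]eq_sym.
have -> : (j == ord_pred i) = (i == ordS j).
  by apply/eqP/eqP => ->; rewrite ?ord_predK ?ordSK.
by case: (i == j); case: (i == ordS j); case: (j == ordS i).
Qed.

(** Two edges [v_i u_i] and [v_j u_j] with [i] and [j] not near have distinct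
    ends by the axioms of a sprout, and an adjacency between their ends is
    precisely what infertility asserts. *)
Lemma no_fertile_sunflower5 (G F : sgraph) :
  perfect (square (line_graph G)) -> fertile_sunflower_sprout 5 F ->
  ~ contains_induced G F.
Proof.
move=> perfG [v [u [[_ v_inj v_adj vu_neq _ u_neq vu_adj] fert]]] FG.
apply: (@no_sprout_pentagon G F v u) => // i j ij.
rewrite /edges_close /close v_adj (inj_eq v_inj) (negbTE ij) /=.
have [//|not_ij] := boolP (cycle_adj i j).
have far : ~~ cyc_near i j by rewrite cyc_nearE negb_or ij.
have far' : ~~ cyc_near j i.
  by rewrite cyc_nearE negb_or eq_sym ij /= cycle_sym.
rewrite (negbTE (vu_neq i j)) [u i == v j]eq_sym (negbTE (vu_neq j i)).
rewrite (negbTE (u_neq i j far)) [adj (v i) _]adj_sym /=.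
apply/or3P => -[] adj_ij; apply: fert.
- by exists j, i; split; last right.
- by exists i, j; split; last right.
- by exists i, j; split; last left.
Qed.

Lemma all5 (P : nat -> nat -> bool) :
  all (fun i => all (P i) (iota 0 5)) (iota 0 5) -> forall i j : 'I_5, P i j.
Proof.
move=> /allP allP5 i j.
have /allP allPi : all (P i) (iota 0 5) by apply: allP5; rewrite mem_iota /=.
by apply: allPi; rewrite mem_iota /=.
Qed.

(** The vertices are numbered 0 to 8 in the order of [Z], so that adjacency is
    bounded below by the required pairs of numbers and above by the required or
    optional ones. Both bounds agree on which of the five chosen edges are
    close, and this is decided by computation. *)
Lemma no_fertile_type_A (G F : sgraph) :
  perfect (square (line_graph G)) -> fertile_sprout_type_A F ->
  ~ contains_induced G F.
Proof.
move=> perfG [x1 [x2 [x3 [x4 [x5 [x6 [y6 [y1 [y2 /=]]]]]]]]].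
set Z := [:: x1; _; _; _; _; _; _; _; _]; case=> Z_uniq _ req_adj adj_opt FG.
pose z i := nth x1 Z i; pose zz (p : nat * nat) := (z p.1, z p.2).
pose R := [:: (0, 1); (1, 2); (2, 3); (3, 4); (4, 5); (5, 0); (6, 5); (7, 0);
              (8, 1)].
pose O := [:: (7, 8); (7, 1); (7, 5); (8, 0); (8, 2); (6, 7); (6, 0); (6, 4)].
have z_eq i j : i < 9 -> j < 9 -> (z i == z j) = (i == j).
  by move=> ? ?; rewrite nth_uniq.
pose joined p q := ((p, q) \in R) || ((q, p) \in R).
have z_req i j : joined i j -> adj (z i) (z j).
  case/orP=> ijR; last rewrite adj_sym; apply: req_adj; exact: (map_f zz ijR).
have z_opt i j : i < 9 -> j < 9 -> adj (z i) (z j) ->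
    ((i, j) \in R ++ O) || ((j, i) \in R ++ O).
  have mem_zz p q : p < 9 -> q < 9 -> zz (p, q) \in map zz (R ++ O) ->
      (p, q) \in R ++ O.
    move=> p9 q9 /mapP[[p' q'] pqRO [zp zq]].
    have /andP[p'9 q'9] : (p' < 9) && (q' < 9).
      have /allP/(_ _ pqRO) // : all (fun r => (r.1 < 9) && (r.2 < 9)) (R ++ O).
      by [].
    by move/eqP: zp; move/eqP: zq; rewrite !z_eq // => /eqP -> /eqP ->.
  move=> i9 j9 /adj_opt /orP[] ijRO; apply/orP; [left | right]; exact: mem_zz.
(* The chosen edges are x1 y1, x2 y2, x3 x4, x5 x4 and x6 y6; the fourth is
   written from x5 because x4 already is an end of the third. *)
pose A := [:: 0; 1; 2; 4; 5]; pose B := [:: 7; 8; 3; 3; 6].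
pose any (r : rel nat) i j :=
  let a := nth 0 A in let b := nth 0 B in
  [|| r (a i) (a j), r (a i) (b j), r (b i) (a j) | r (b i) (b j)].
pose lo := any joined.
pose hi := any (fun p q =>
  [|| p == q, (p, q) \in R ++ O | (q, p) \in R ++ O]).
have A9 i : nth 0 A i < 9 by move: i; do 6![case=> //].
have B9 i : nth 0 B i < 9 by move: i; do 6![case=> //].
apply: (@no_sprout_pentagon G F (z \o nth 0 A) (z \o nth 0 B)) => //=.
- move=> i j /= /eqP; rewrite z_eq // nth_uniq // => /eqP; apply: val_inj.
- move=> i j; rewrite z_eq //.
  by apply: (@all5 (fun p q => nth 0 A p != nth 0 B q)).
- move=> i; apply: z_req.
  have := @all5 (fun p q => (p != q) || joined (nth 0 A p) (nth 0 B q)) isT i i.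
  by rewrite eqxx.
move=> i j ij.
pose cyc p q := [|| q == p.+1, (q == 0) && (p == 4), p == q.+1
                 | (p == 0) && (q == 4)].
have -> : cycle_adj i j = cyc i j.
  by rewrite /cycle_adj ij !eq_ordS /cyc !eqSS -orbA.
have lo_close p q : joined p q -> close (z p) (z q).
  by rewrite /close => /z_req ->; rewrite orbT.
have close_hi p q : p < 9 -> q < 9 -> close (z p) (z q) ->
    [|| p == q, (p, q) \in R ++ O | (q, p) \in R ++ O].
  by move=> ? ?; rewrite /close z_eq // => /orP[-> //|/z_opt -> //]; rewrite orbT.
have : [|| i == j :> nat, cyc i j && lo i j | ~~ cyc i j && ~~ hi i j].
  by apply: (@all5 (fun p q =>
    [|| p == q, cyc p q && lo p q | ~~ cyc p q && ~~ hi p q])).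
rewrite val_eqE (negbTE ij) /= => /orP[] /andP[].
  move=> -> /or4P lo_ij; apply/or4P.
  by case: lo_ij => /lo_close;
    [constructor 1|constructor 2|constructor 3|constructor 4].
move=> /negbTE ->; apply: contraNF => /or4P cl_ij; apply/or4P.
by case: cl_ij => cl; [constructor 1|constructor 2|constructor 3|constructor 4];
  apply: (close_hi _ _ _ _ cl).
Qed.

Theorem theorem4p55 (G : sgraph) (hG : perfect (square (line_graph G))) :
  (forall n : nat, 7 <= n -> ~ contains_induced G (cycle_graph n)) /\
  (forall S : sgraph, fertile_sunflower_sprout 5 S -> ~ contains_induced G S) /\
  (forall S : sgraph, fertile_sprout_type_A S -> ~ contains_induced G S).
Proof.
split=> [n|]; first exact: no_long_cycle.
by split=> F; [apply: no_fertile_sunflower5 | apply: no_fertile_type_A].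
Qed.
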